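(* For every algebraic model $\mathcal{M}$ and every assignment $\gamma:V\to M$ there is a frame-based model $\mathcal{K}=(\mathcal{F},g)$ such that for all formulas $\varphi$: $(\mathcal{M},\gamma)\vDash\varphi$ if and only if $\mathcal{K}\vDash\varphi$.
   Context: Language: formulas $Fm$ are built from propositional variables $V$ with $\neg,\rightarrow$ and unary operators $\square,K,B$. Algebraic models: $\mathcal{M}=(M,\mathit{TRUE},\vee,\wedge,\neg,0,1,\square,B,K)$ where $(M,\vee,\wedge,\neg,0,1)$ is a Boolean algebra, $\mathit{TRUE}$ is an ultrafilter, and $\square,B,K:M\to M$ satisfy: (1) $\square a=1$ if $a=1$ and $\square a=0$ otherwise; (2) for every ultrafilter $U$, $\mathit{KNOW}(U)=\{a: Ka\in U\}$ and $\mathit{BEL}(U)=\{a: Ba\in U\}$ are proper filters with $\mathit{KNOW}(U)\subseteq U\cap\mathit{BEL}(U)$. An assignment $\gamma:V\to M$ extends homomorphically to $Fm$ (with $a\rightarrow b=\neg a\vee b$ and $\square,K,B$ interpreted by the operations); $(\mathcal{M},\gamma)\vDash\varphi$ iff $\gamma(\varphi)\in\mathit{TRUE}$. Frames: $\mathcal{F}=(W,P,E_K,E_B,w_T)$ where $W$ is a nonempty set of worlds, $w_T\in W$ a designated world, $P\subseteq\mathcal{P}(W)$ contains $\varnothing$ and $W$ and is closed under $A\cap B$, $A\cup B$, $W\setminus A$, $KA:=\{w\in W: A\in E_K(w)\}$ and $BA:=\{w\in W: A\in E_B(w)\}$; $E_K:W\to\mathcal{P}(P)$ assigns to each $w$ a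 filter on $P$ (nonempty, closed under finite intersections and under supersets in $P$) satisfying factivity ($A\in E_K(w)$ implies $w\in A$); $E_B:W\to\mathcal{P}(P)$ assigns to each $w$ a proper filter on $P$ with $E_K(w)\subseteq E_B(w)$. A frame-based model is $\mathcal{K}=(\mathcal{F},g)$ with $g:V\to P$; satisfaction at worlds: $w\vDash x$ iff $w\in g(x)$; $w\vDash\neg\varphi$ iff $w\nvDash\varphi$; $w\vDash\varphi\rightarrow\psi$ iff $w\nvDash\varphi$ or $w\vDash\psi$; $w\vDash\square\varphi$ iff $w'\vDash\varphi$ for all $w'\in W$; $w\vDash K\varphi$ iff $\varphi^*\in E_K(w)$; $w\vDash B\varphi$ iff $\varphi^*\in E_B(w)$, where $\varphi^*=\{w\in W: w\vDash\varphi\}$. $\mathcal{K}\vDash\varphi$ iff $w_T\vDash\varphi$. *)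

(* Defs.v *)
From HB Require Import structures.
From mathcomp Require Import all_boot all_order.
From mathcomp Require Import boolp classical_sets.

Set Implicit Arguments.
Unset Strict Implicit.
Unset Printing Implicit Defensive.

Local Open Scope classical_set_scope.

Inductive formula (V : Type) : Type :=
| Var of V
| Neg of formula V
| Imp of formula V & formula V
| Box of formula V
| Know of formula V
| Bel of formula V.

Section BooleanAlgebraFilters.
Variables (d : Order.disp_t) (M : ctbDistrLatticeType d).
Implicit Types (F U : set M) (a b : M).

Definition ba_filter F : Prop :=
  [/\ F !=set0,
      forall a b, F a -> F b -> F (a `&` b)%O
    & forall a b, F a -> (a <= b)%O -> F b].

Definition ba_proper_filter F : Prop := ba_filter F /\ ~ F \bot%O.

Definition ba_ultrafilter U : Prop :=
  ba_proper_filter U /\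
  forall F, ba_proper_filter F -> U `<=` F -> F = U.

Definition KNOW (K : M -> M) U : set M := [set a | U (K a)].
Definition BEL (B : M -> M) U : set M := [set a | U (B a)].

End BooleanAlgebraFilters.

(* A ctbDistrLatticeType is a Boolean algebra; it may be degenerate, but the
   existence of the ultrafilter [TRUE] excludes [\bot = \top]. *)
Record alg_model : Type := AlgModel {
  am_disp : Order.disp_t;
  am_carrier :> ctbDistrLatticeType am_disp;
  TRUE : set am_carrier;
  am_box : am_carrier -> am_carrier;
  am_B : am_carrier -> am_carrier;
  am_K : am_carrier -> am_carrier;
  TRUE_ultra : ba_ultrafilter TRUE;
  am_box_top : forall a, a = \top%O -> am_box a = \top%O;
  am_box_neq_top : forall a, a <> \top%O -> am_box a = \bot%O;
  KNOW_proper : forall U, ba_ultrafilter U -> ba_proper_filter (KNOW am_K U);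
  BEL_proper : forall U, ba_ultrafilter U -> ba_proper_filter (BEL am_B U);
  KNOW_sub : forall U, ba_ultrafilter U -> KNOW am_K U `<=` U `&` BEL am_B U
}.

Fixpoint alg_eval (V : Type) (M : alg_model) (gamma : V -> M)
    (phi : formula V) : M :=
  match phi with
  | Var x => gamma x
  | Neg p => (~` alg_eval gamma p)%O
  | Imp p q => (~` alg_eval gamma p `|` alg_eval gamma q)%O
  | Box p => am_box (alg_eval gamma p)
  | Know p => am_K (alg_eval gamma p)
  | Bel p => am_B (alg_eval gamma p)
  end.

Definition alg_sat (V : Type) (M : alg_model) (gamma : V -> M)
    (phi : formula V) : Prop :=
  TRUE (alg_eval gamma phi).

Section FieldFilters.
Variables (W : Type) (P : set (set W)).
Implicit Types (F : set (set W)) (A B : set W).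

Definition filter_on F : Prop :=
  [/\ F `<=` P,
      F !=set0,
      forall A B, F A -> F B -> F (A `&` B)
    & forall A B, F A -> P B -> A `<=` B -> F B].

Definition proper_filter_on F : Prop := filter_on F /\ ~ F set0.

End FieldFilters.

Record frame : Type := Frame {
  world : Type;
  props : set (set world);
  EK : world -> set (set world);
  EB : world -> set (set world);
  wT : world;
  props_set0 : props set0;
  props_setT : props setT;
  props_setI : forall A B, props A -> props B -> props (A `&` B);
  props_setU : forall A B, props A -> props B -> props (A `|` B);
  props_setC : forall A, props A -> props (~` A);
  props_K : forall A, props A -> props [set w | EK w A];
  props_B : forall A, props A -> props [set w | EB w A];
  EK_filter : forall w, filter_on props (EK w);
  EK_fact : forall w A, EK w A -> A w;
  EB_filter : forall w, proper_filter_on props (EB w);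
  EK_sub_EB : forall w, EK w `<=` EB w
}.

Record frame_model (V : Type) : Type := FrameModel {
  fm_frame :> frame;
  fm_val : V -> set (world fm_frame);
  fm_valP : forall x, props (fm_val x)
}.

Fixpoint world_sat (V : Type) (K : frame_model V) (phi : formula V)
    (w : world K) : Prop :=
  match phi with
  | Var x => fm_val x w
  | Neg p => ~ world_sat p w
  | Imp p q => ~ world_sat p w \/ world_sat q w
  | Box p => forall w' : world K, world_sat p w'
  | Know p => EK w [set w' | world_sat p w']
  | Bel p => EB w [set w' | world_sat p w']
  end.

Definition frame_sat (V : Type) (K : frame_model V) (phi : formula V) : Prop :=
  world_sat phi (wT K).

(* Main.v *)
Require Import Defs.
From mathcomp Require Import all_boot all_order.
From mathcomp Require Import boolp classical_sets.

(** Stone duality.  Worlds are the ultrafilters of [M], propositions are the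
    sets [stone a] of ultrafilters containing [a], the designated world is
    [TRUE], and [stone a] is known (believed) at [U] when [K a] ([B a]) lies
    in [U].  By the ultrafilter theorem [stone] is an order embedding, hence
    the neighbourhoods are well defined filters and [stone] commutes with [K]
    and [B]; it also sends [\top] and no other element to the set of all worlds,
    which handles [Box].  So every formula is true exactly at the ultrafilters
    containing its value. *)

Set Implicit Arguments.
Unset Strict Implicit.
Unset Printing Implicit Defensive.

Import Order.Theory.
Local Open Scope classical_set_scope.

(** * Existence of ultrafilters *)

Section Ultrafilters.
Variables (d : Order.disp_t) (M : ctbDistrLatticeType d).
Implicit Types (F G U : set M) (C : set (set M)) (a b c : M).

Lemma ba_filter_top F : ba_filter F -> F \top%O.
Proof. by case=> [[a Fa] _ Fle]; apply: Fle Fa _; rewrite lex1. Qed.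

(** Two elements of the union already lie together in the larger of the two filters they come from,
    since a chain compares them. *)
Lemma ba_proper_filter_bigcup C :
  C !=set0 -> C `<=` @ba_proper_filter _ M -> total_on C subset ->
  ba_proper_filter (\bigcup_(F in C) F).
Proof.
move=> [F0 CF0] Cproper Ctot; split; last by case=> F /Cproper[].
split.
- by exists \top%O, F0 => //; apply: ba_filter_top; case: (Cproper _ CF0).
- move=> a b [F CF Fa] [G CG Gb].
  have [FG|GF] := Ctot F G CF CG.
  + exists G => //; have [[_ GI _] _] := Cproper _ CG.
    exact: GI (FG _ Fa) Gb.
  + exists F => //; have [[_ FI _] _] := Cproper _ CF.
    exact: FI Fa (GF _ Gb).
- move=> a b [F CF Fa] leab; exists F => //.
  by have [[_ _ Fle] _] := Cproper _ CF; apply: Fle Fa leab.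
Qed.

(** Zorn's lemma for the proper filters containing [a]; a maximal one among them is maximal among
    all proper filters, as any extension still contains [a]. *)
Lemma ba_ultrafilter_exists a :
  a <> \bot%O -> exists2 U, ba_ultrafilter U & U a.
Proof.
move=> a_neq0.
(* [set0] is admitted so that the empty chain has an upper bound. *)
pose P : set (set M) := [set F | F = set0 \/ ba_proper_filter F /\ F a].
have [|U [PU Umax]] := @Zorn_bigcup M P.
  (* Dropping the empty set from the chain leaves its union unchanged and only genuine filters in
     it. *)
  move=> C CP Ctot; pose C' := C `&` [set F | F !=set0].
  have C'P F : C' F -> ba_proper_filter F /\ F a.
    by case=> /CP[->|//] [].
  have [C'0|/set0P C'0] := eqVneq C' set0.
    left; rewrite -subset0 => x [F CF Fx].
    by have : C' F by [split=> //; exists x]; rewrite C'0.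
  have -> : \bigcup_(F in C) F = \bigcup_(F in C') F.
    rewrite eqEsubset; split=> x [F CF Fx]; exists F => //.
      by split=> //; exists x.
    by case: CF.
  right; split.
    apply: ba_proper_filter_bigcup => // [F /C'P[]//|F G [CF _] [CG _]].
    exact: Ctot.
  by case: C'0 => F C'F; exists F => //; case: (C'P _ C'F).
(* The principal filter of [a] strictly extends [set0], so the maximal element is not [set0]. *)
have Pa : P [set b | (a <= b)%O].
  right; split=> /=; last exact: lexx.
  split; last by rewrite /= lex0 => /eqP.
  split; first by exists a => /=.
  - by move=> b c /= ab ac; rewrite lexI ab.
  - by move=> b c /= ab; apply: le_trans.
case: PU => [U0|[Uproper Ua]].
  case: (Umax _ _ Pa); rewrite U0; split=> // /(_ a); apply; exact: lexx.
exists U => //; split=> // F Fproper UF.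
apply: contrapT => FU; apply: (Umax F); last by right; split=> //; apply: UF.
by split=> // FleU; apply: FU; rewrite eqEsubset.
Qed.

(** * Ultrafilters respect the Boolean operations *)

Section UltrafilterTheory.
Variables (U : set M) (ultraU : ba_ultrafilter U).

Lemma ultra_top : U \top%O.
Proof. by apply: ba_filter_top; case: ultraU => [[]]. Qed.

Lemma ultra_bot : ~ U \bot%O.
Proof. by case: ultraU => [[]]. Qed.

Lemma ultra_le a b : (a <= b)%O -> U a -> U b.
Proof. by case: ultraU => [[[_ _ Ule] _] _] leab Ua; apply: Ule Ua leab. Qed.

Lemma ultra_meet a b : U (a `&` b)%O <-> U a /\ U b.
Proof.
split=> [Uab|[Ua Ub]]; last by case: ultraU => [[[_ UI _] _] _]; apply: UI.
by split; apply: ultra_le Uab; rewrite (leIl, leIr).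
Qed.

Lemma ultra_compl a : U (~` a)%O <-> ~ U a.
Proof.
split=> [UCa Ua|nUa].
  by apply: ultra_bot; rewrite -(meetxC a); apply/ultra_meet.
apply: contrapT => nUCa; apply: nUa.
(* The filter generated by [U] and [a]. Were it improper, some [u] in [U] would lie below the
   complement of [a]; so it is proper, and maximality puts [a] in [U]. *)
pose F := [set c | exists2 u, U u & (u `&` a <= c)%O].
have UF : U `<=` F by move=> u Uu; exists u => //; rewrite leIl.
suff Fproper : ba_proper_filter F.
  rewrite -(ultraU.2 F Fproper UF).
  by exists \top%O; [exact: ultra_top | rewrite leIr].
split; last first.
  case=> u Uu; rewrite lex0 disj_leC => /ultra_le uCa; exact: nUCa (uCa Uu).
split.
- by exists \top%O; apply: UF; exact: ultra_top.
- move=> b c [u Uu uab] [v Uv vac]; exists (u `&` v)%O; first exact/ultra_meet.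
  rewrite lexI (le_trans _ uab) ?(le_trans _ vac) //.
  + by rewrite leI2 // leIr.
  + by rewrite leI2 // leIl.
- by move=> b c [u Uu uab] bc; exists u => //; apply: le_trans bc.
Qed.

Lemma ultra_join a b : U (a `|` b)%O <-> U a \/ U b.
Proof.
rewrite -[(a `|` b)%O]complK complU ultra_compl ultra_meet !ultra_compl.
by rewrite not_andE !not_notE.
Qed.

End UltrafilterTheory.

(** * The Stone embedding and its neighbourhoods *)

Definition ultra : Type := {U : set M | ba_ultrafilter U}.
Implicit Type w : ultra.

Definition stone a : set ultra := [set w | sval w a].

(** Otherwise the difference of [a] and [b] is nonzero, and an ultrafilter containing it contains
    [a] but not [b]. *)
Lemma stone_sub a b : stone a `<=` stone b -> (a <= b)%O.
Proof.
move=> ab; rewrite -diff_eq0; apply/eqP; apply: contrapT => nz.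
have [U ultraU] := ba_ultrafilter_exists nz.
rewrite diffE => /(ultra_meet ultraU)[Ua /(ultra_compl ultraU)]; apply.
exact: (ab (exist _ U ultraU)).
Qed.

Lemma stone_inj : injective stone.
Proof.
by move=> a b eq_ab; apply/le_anti/andP; split; apply: stone_sub; rewrite eq_ab.
Qed.

Lemma stone_bot : stone \bot%O = set0.
Proof. by rewrite -subset0 => -[U ultraU] /(ultra_bot ultraU). Qed.

Lemma stone_top : stone \top%O = setT.
Proof. by rewrite -subTset => -[U ultraU] _; apply: ultra_top. Qed.

Lemma stone_meet a b : stone (a `&` b)%O = stone a `&` stone b.
Proof. by apply/funext => -[U ultraU]; apply/propext/ultra_meet. Qed.

Lemma stone_join a b : stone (a `|` b)%O = stone a `|` stone b.
Proof. by apply/funext => -[U ultraU]; apply/propext/ultra_join. Qed.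

Lemma stone_compl a : stone (~` a)%O = ~` stone a.
Proof. by apply/funext => -[U ultraU]; apply/propext/ultra_compl. Qed.

Definition stone_nbhd (f : M -> M) w : set (set ultra) :=
  stone @` [set a | sval w (f a)].

(** Injectivity of [stone] makes membership independent of the element chosen to represent a
    proposition. *)
Lemma stone_nbhdE f w a : stone_nbhd f w (stone a) <-> stone (f a) w.
Proof. by split=> [[b /= wfb /stone_inj <-]|]; last by exists a. Qed.

Lemma stone_nbhd_proper f w :
  ba_proper_filter [set a | sval w (f a)] ->
  proper_filter_on (range stone) (stone_nbhd f w).
Proof.
move=> [[[a wfa] wfI wfle] wf0]; split; last first.
  by rewrite -stone_bot => /stone_nbhdE.
split; first by move=> _ [b _ <-]; exists b.
- by exists (stone a); exists a.
- by move=> _ _ [b wfb <-] [c wfc <-]; rewrite -stone_meet; exists (b `&` c)%O;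
    first exact: wfI.
- move=> _ _ [b wfb <-] [c _ <-] /stone_sub bc; exists c => //.
  exact: wfle wfb bc.
Qed.

End Ultrafilters.

(** * The Stone frame and the truth lemma *)

Section StoneFrame.
Variable M : alg_model.

#[local] Obligation Tactic := idtac.

Program Definition stone_frame : frame := {|
  world := ultra M;
  props := range (@stone _ M);
  EK := stone_nbhd (@am_K M);
  EB := stone_nbhd (@am_B M);
  wT := exist _ _ (TRUE_ultra M)
|}.
Next Obligation. by exists \bot%O => //; apply: stone_bot. Qed.
Next Obligation. by exists \top%O => //; apply: stone_top. Qed.
Next Obligation.
by move=> _ _ [a _ <-] [b _ <-]; exists (a `&` b)%O => //; apply: stone_meet.
Qed.
Next Obligation.
by move=> _ _ [a _ <-] [b _ <-]; exists (a `|` b)%O => //; apply: stone_join.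
Qed.
Next Obligation.
by move=> _ [a _ <-]; exists (~` a)%O => //; apply: stone_compl.
Qed.
Next Obligation.
move=> _ [a _ <-]; exists (am_K a) => //.
by apply/funext => w; apply/esym/propext/stone_nbhdE.
Qed.
Next Obligation.
move=> _ [a _ <-]; exists (am_B a) => //.
by apply/funext => w; apply/esym/propext/stone_nbhdE.
Qed.
Next Obligation.
move=> w; have [] // := @stone_nbhd_proper _ M (@am_K M) w.
exact: KNOW_proper (svalP w).
Qed.
Next Obligation.
by move=> w _ [a wKa <-]; have [] := KNOW_sub (svalP w) wKa.
Qed.
Next Obligation.
by move=> w; apply: stone_nbhd_proper; apply: BEL_proper (svalP w).
Qed.
Next Obligation.
move=> w _ [a wKa <-]; apply/stone_nbhdE.
by have [] := KNOW_sub (svalP w) wKa.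
Qed.

Variables (V : Type) (gamma : V -> M).

Definition stone_model : frame_model V :=
  @FrameModel V stone_frame (fun x => stone (gamma x))
    (fun x => imageT (@stone _ M) (gamma x)).

(** Induction on [phi]. An equality of sets is needed because [Know] and [Bel] test the whole truth
    set against a neighbourhood. *)
Lemma stone_truth (phi : formula V) :
  [set w : world stone_model | world_sat phi w] = stone (alg_eval gamma phi).
Proof.
elim: phi => [x|p IH|p IHp q IHq|p IH|p IH|p IH] //=.
- by rewrite stone_compl -IH.
- by rewrite stone_join stone_compl -IHp -IHq.
- have [eval1|eval1] := pselect (alg_eval gamma p = \top%O).
    rewrite (am_box_top eval1) stone_top -subTset => w _ w'.
    suff : [set w : world stone_model | world_sat p w] w' by [].
    by rewrite IH eval1 stone_top.
  (* If [p] held at every world, its value would have the same image under [stone] as [\top], hence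
     equal it. *)
  rewrite (am_box_neq_top eval1) stone_bot -subset0 => w /= all_p.
  apply/eval1/stone_inj; rewrite stone_top -IH -subTset => w' _.
  exact: all_p.
- by rewrite IH; apply/funext => w; apply/propext/stone_nbhdE.
- by rewrite IH; apply/funext => w; apply/propext/stone_nbhdE.
Qed.

End StoneFrame.

Theorem theorem3p13 (V : Type) (M : alg_model) (gamma : V -> M) :
  exists K : frame_model V,
    forall phi : formula V, alg_sat gamma phi <-> frame_sat K phi.
Proof.
exists (stone_model gamma) => phi; rewrite /frame_sat.
(* The right-hand side unfolds to membership of the value of [phi] in [TRUE]. *)
suff -> : world_sat phi (wT (stone_model gamma)) =
          stone (alg_eval gamma phi) (wT (stone_frame M)) by [].
by rewrite -stone_truth.
Qed.
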